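(* Let $k\geq2$ be an integer, let $N\geq1$ and $C_0\geq1$. There are constants $c=c(k,C_0)>0$ and $C=C(k)\geq1$ such that the following holds. Let $0<\delta<c$, let $H$ be a positive integer, set $B=N/H$, and suppose that $$\delta^{-C}\leq B\leq N\delta^{C}.$$ Let $\lambda\colon\mathbb Z^k\to\mathbb C$ be $1$-bounded and supported on $([-C_0B,C_0B]\cap\mathbb Z)^k$, and let $f_1,\ldots,f_k\colon\mathbb Z\to\mathbb C$ be $1$-bounded and supported on $[N]$. If $$|R_H(\lambda;f_1,\ldots,f_k)|\geq\delta B^k\frac{N^2}{B},$$ then $$\min_{1\leq i\leq k}\|f_i\|_{U^{1+}[N]}\geq c\,\delta^C.$$
   Context: For a real number $X\geq1$, $[X]=\{1,\ldots,\lfloor X\rfloor\}$. A function is $1$-bounded if its values have modulus at most $1$. The constant $c$ depends only on $k,C_0$ and $C$ only on $k$ (not on $N$). Counting operator: for $\lambda\colon\mathbb Z^k\to\mathbb C$ and finitely supported $f_1,\ldots,f_k\colon\mathbb Z\to\mathbb C$, $$R_H(\lambda;f_1,\ldots,f_k)=\sum_{\mathbf b=(b_1,\ldots,b_k)\in\mathbb Z^k}\lambda(\mathbf b)\sum_{x\in\mathbb Z}\sum_{m\in[H]}\prod_{i=1}^kf_i(x+b_im).$$ Norm: $\displaystyle\|f\|_{U^{1+}[N]}=\frac1{|[N]|}\max_{P}\Bigl|\sum_{n\in P}f(n)\Bigr|$, the maximum being over all arithmetic progressions $P\subseteq[N]$. *)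

(* Defs.v *)
From HB Require Import structures.
From mathcomp Require Import all_boot all_order all_algebra finmap.
From mathcomp Require Export complex.
From mathcomp Require Import all_classical reals exp.

Set Implicit Arguments.
Unset Strict Implicit.
Unset Printing Implicit Defensive.

Import Order.TTheory GRing.Theory Num.Theory.
Import ComplexField.Normc.
Local Open Scope classical_set_scope.
Local Open Scope ring_scope.

(* [X] = {1, ..., floor X}, as a set of integers *)
Definition initial_segment (R : realType) (X : R) : set int :=
  [set n : int | 1 <= n <= Num.floor X].

Definition one_bounded (R : realType) (T : Type) (f : T -> R[i]) : Prop :=
  forall x, normc (f x) <= 1.

Definition supported_on (R : realType) (T : Type) (f : T -> R[i])
    (A : set T) : Prop :=
  [set x | f x <> 0] `<=` A.

(* The convention of \sum_(_ \in _), which is 0 on a family of infinite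
   support, plays no role when lambda and the f i are finitely supported. *)
Definition counting_operator (R : realType) (H k : nat)
    (lambda : {ffun 'I_k -> int} -> R[i]) (f : 'I_k -> int -> R[i]) : R[i] :=
  \sum_(b \in [set: {ffun 'I_k -> int}])
    lambda b *
    (\sum_(x \in [set: int]) \sum_(1 <= m < H.+1)
      \prod_(i < k) f i (x + b i * m%:Z)).

(* nonempty finite progressions {a, a + q, ..., a + (L - 1) q} *)
Definition arith_progression (P : set int) : Prop :=
  exists (a q : int) (L : nat), [/\ 0 < q, (0 < L)%N &
    P = [set a + q * j%:Z | j in `I_L]].

Definition progression_sums (R : realType) (N : R) (f : int -> R[i]) : set R :=
  [set normc (\sum_(n \in P) f n) | P in
    [set P : set int | arith_progression P /\ P `<=` initial_segment N]].

(* For 1 <= N the supremum is a maximum, see progression_sums_max. *)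
Definition U1plus_norm (R : realType) (N : R) (f : int -> R[i]) : R :=
  (#|` fset_set (initial_segment N)|%fset%:R)^-1 * sup (progression_sums N f).

Lemma finite_initial_segment (R : realType) (X : R) :
  finite_set (initial_segment X).
Proof.
apply: (@sub_finite_set _ _ [set m%:Z | m in `I_(`|Num.floor X|%N.+1)]); last first.
  exact/finite_image/finite_II.
move=> n /= /andP[n1 nX]; case: n n1 nX => // n _ nX.
exists n => //=; rewrite ltnS -lez_nat (le_trans nX)//; exact: lez_abs.
Qed.

Lemma card_initial_segment (R : realType) (X : R) : 1 <= X ->
  (#|` fset_set (initial_segment X)|%fset)%:Z = Num.floor X.
Proof.
move=> X1; have: 1 <= Num.floor X by rewrite floor_ge_int.
case E : (Num.floor X) => [n|//] _; congr Posz.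
apply: card_fset_set.
have -> : initial_segment X = [set m.+1%:Z | m in `I_n].
  rewrite /initial_segment E; apply/seteqP; split => z /=.
    by case: z => [[//|m]|//] /= mn; exists m.
  by move=> [m mn <-].
rewrite card_eq_sym; apply/card_esym => //.
by apply: inj_card_eq => x y _ _ [].
Qed.

Lemma finite_progression_sums (R : realType) (N : R) (f : int -> R[i]) :
  finite_set (progression_sums N f).
Proof.
apply: finite_image.
pose S := fset_set (initial_segment N).
apply: (@sub_finite_set _ _ [set [set` Q] | Q in [set` fpowerset S]]); last first.
  exact/finite_image/finite_fset.
move=> P [_ PN]; have finP := sub_finite_set PN (finite_initial_segment N).
exists (fset_set P); last by rewrite fset_setK.
rewrite /= fpowersetE; apply/fsubsetP => z.
rewrite !in_fset_set//; last exact: finite_initial_segment.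
by rewrite !inE => /PN.
Qed.

Lemma progression_sums_max (R : realType) (N : R) (f : int -> R[i]) : 1 <= N ->
  progression_sums N f (sup (progression_sums N f)) /\
  ubound (progression_sums N f) (sup (progression_sums N f)).
Proof.
move=> N1; set A := progression_sums N f.
have finA : finite_set A by exact: finite_progression_sums.
have A0 : A !=set0.
  exists (normc (\sum_(n \in [set 1%:Z]) f n)); exists [set 1%:Z] => //.
  split.
    exists 1, 1, 1%N; split=> //; apply/seteqP; split => z /=.
      by move=> ->; exists 0%N => //; rewrite mulr0 addr0.
    by move=> [[|//] _ <-]; rewrite mulr0 addr0.
  by move=> z ->; rewrite /initial_segment /= floor_ge_int N1.
have [x Ax xA] : exists2 x, A x & ubound A x.
  move: (fset_setK finA); set s := fset_set A => sA.
  have [a Aa] := A0.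
  have as_ : a \in s by rewrite in_fset_set// inE.
  exists (\big[Num.max/a]_(y <- s) y).
    rewrite -sA /= big_seq; apply: (big_ind (fun y => y \in s)) => //.
      by move=> y z ys zs; rewrite maxElt; case: ifP.
  move=> y Ay; have ys : y \in s by rewrite in_fset_set// inE.
  exact: (@le_bigmax_seq _ _ _ _ _ _ predT id ys).
suff -> : sup A = x by [].
apply/eqP; rewrite eq_le; apply/andP; split; first exact: ge_sup.
by apply: ub_le_sup => //; exists x.
Qed.

(* Main.v *)
Require Import Defs.
From mathcomp Require Import all_boot all_order all_algebra.
From mathcomp Require Import all_classical reals exp.
From mathcomp Require Import cyclic separable cyclotomic.
From mathcomp Require Import zify ring lra.
Import Order.TTheory GRing.Theory Num.Theory.
Import ComplexField.Normc.
Local Open Scope classical_set_scope.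
Local Open Scope ring_scope.

(* Fix i and f = f_i.  Choosing the other b_j well and applying Cauchy-Schwarz
   over (x, m) bounds R_H by the energy sum_m sum_x |sum_t c_t f(x + t m)|^2
   with phases |c_t| <= 1.  By Parseval a sum over x of |sum_s c_s f(x + a_s)|^2
   is sum_j p_j |sum_s c_s w_j^(a_s)|^2 for frequencies |w_j| = 1 and weights
   p_j >= 0 of total mass at most N, so opening the square makes
   sum_d |sum_m w^(d m)| large on a set of frequencies of mass >> delta^2 N.
   Such a w satisfies |w^d - 1| << 1/H for many d << B, hence, as in
   Vinogradov's lemma, |w^q - 1| << 1/(H B) = 1/N for some small q.  On these
   frequencies sum_(l < L) w^(q l) has no cancellation for L ~ N, up to powers
   of delta, and Parseval used backwards yields a progression x + q l, l < L, on
   which f has a large sum. *)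

(** * Unimodular numbers and geometric sums *)

Lemma normc_ge0 {R : realType} (x : R[i]) : 0 <= normc x.
Proof. by case: x => a b /=; exact: sqrtr_ge0. Qed.

Lemma normc_sum {R : realType} (I : Type) (r : seq I) (P : pred I) (F : I -> R[i]) :
  normc (\sum_(i <- r | P i) F i) <= \sum_(i <- r | P i) normc (F i).
Proof.
elim/big_ind2: _ => [|x a y b xa yb|//]; first by rewrite normc0.
exact: le_trans (le_normcD _ _) (lerD xa yb).
Qed.

Lemma normc_prod {R : realType} (I : Type) (r : seq I) (P : pred I) (F : I -> R[i]) :
  normc (\prod_(i <- r | P i) F i) = \prod_(i <- r | P i) normc (F i).
Proof.
elim/big_ind2: _ => [|x a y b <- <-|//]; first exact: normc1.
exact: normcM.
Qed.

Lemma normcX {R : realType} (z : R[i]) n : normc (z ^+ n) = normc z ^+ n.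
Proof. by elim: n => [|n IH]; rewrite ?expr0 ?normc1// !exprS normcM IH. Qed.

Lemma normc_nat {R : realType} n : normc (n%:R : R[i]) = n%:R.
Proof. by rewrite normcMn normc1. Qed.

Lemma sqr_normcE {R : realType} (x : R[i]) : ((normc x ^+ 2)%:C)%C = x * (x^*)%C.
Proof. by rewrite -sqr_normc -rmorphXn. Qed.

Lemma normc_conj {R : realType} (x : R[i]) : normc (x^*)%C = normc x.
Proof. by case: x => a b /=; rewrite sqrrN. Qed.

Section Unimodular.
Context {R : realType} {z : R[i]} (z1 : normc z = 1).

Lemma unimodular_neq0 : z != 0.
Proof. by apply/eqP => z0; move: z1; rewrite z0 normc0 => /eqP; rewrite eq_sym oner_eq0. Qed.

Lemma normc_unimodularXz (h : int) : normc (z ^ h) = 1.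
Proof. by case: h => n; rewrite ?NegzE -?exprVn /= ?normcV normcX z1 ?expr1n ?invr1. Qed.

Lemma conj_unimodularXz (h : int) : ((z ^ h)^*)%C = z ^ (- h).
Proof.
have zh0 : z ^ h != 0 by rewrite expfz_neq0 ?unimodular_neq0.
apply: (mulfI zh0); rewrite -sqr_normcE normc_unimodularXz expr1n.
by rewrite -expfzDr ?unimodular_neq0// subrr expr0z.
Qed.

Lemma normc_unimodularX_sub1 (n : nat) : normc (z ^+ n - 1) <= n%:R * normc (z - 1).
Proof.
rewrite subrX1 normcM mulrC ler_wpM2r ?normc_ge0//.
apply: le_trans (normc_sum _ _ _ _) _.
rewrite (eq_bigr (fun=> 1)) ?sumr_const ?card_ord//.
by move=> i _; rewrite normcX z1 expr1n.
Qed.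

(** Since [z ^+ n] is within [n * |z - 1|] of 1, the sum is within [|z - 1| * L * (L - 1) / 2],
    hence within [L / 2], of [L]. *)
Lemma geometric_sum_lower (L : nat) : L%:R * normc (z - 1) <= 1 ->
  L%:R / 2 <= normc (\sum_(n < L) z ^+ n).
Proof.
move=> Lt; set t := normc (z - 1) in Lt.
have t0 : 0 <= t by exact: normc_ge0.
have dev : normc (\sum_(n < L) (z ^+ n - 1)) <= L%:R / 2.
  apply: le_trans (normc_sum _ _ _ _) _.
  have: \sum_(n < L) normc (z ^+ n - 1) <= \sum_(n < L) n%:R * t.
    by apply: ler_sum => n _; exact: normc_unimodularX_sub1.
  move/le_trans; apply; rewrite -mulr_suml.
  have sumE : (\sum_(n < L) n%:R : R) *+ 2 = L%:R * (L%:R - 1).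
    elim: (L) => [|l IH]; first by rewrite big_ord0 mul0rn mul0r.
    by rewrite big_ord_recr /= mulrnDl IH -(@natr1 _ l) -mulr_natr; ring.
  have L0 : 0 <= L%:R :> R by [].
  have : (\sum_(n < L) n%:R : R) *+ 2 * t <= L%:R.
    rewrite sumE -mulrA; case: (L) Lt L0 => [|l]; first by rewrite !mul0r.
    move=> Lt _; rewrite -[leRHS]mulr1 ler_wpM2l// (le_trans _ Lt)//.
    by rewrite ler_wpM2r// lerBlDr lerDl.
  by rewrite -mulr_natr; lra.
have := le_normcD (\sum_(n < L) z ^+ n) (- \sum_(n < L) (z ^+ n - 1)).
rewrite normcN -sumrB (eq_bigr (fun=> 1)); last by move=> i _; rewrite subKr.
rewrite sumr_const card_ord normc_nat; lra.
Qed.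

(** As long as the powers have not wound around the circle, the geometric sum that is the cofactor
    of [z - 1] in [z ^+ s - 1] has no cancellation. Closeness of [z ^+ s] to 1 thus bounds [s] from
    above. *)
Lemma normc_unimodularX_sub1_lower (s : nat) : s%:R * normc (z - 1) <= 1 ->
  s%:R / 2 * normc (z - 1) <= normc (z ^+ s - 1).
Proof.
move=> st; rewrite subrX1 normcM mulrC ler_wpM2l ?normc_ge0//.
exact: geometric_sum_lower.
Qed.

(** Telescoping; the product form includes [z = 1]. *)
Lemma geometric_sum_upper (H : nat) :
  normc (\sum_(1 <= m < H.+1) z ^+ m) * normc (z - 1) <= 2.
Proof.
rewrite -normcM mulrC big_add1 /= big_mkord.
under eq_bigr do rewrite exprS.
rewrite -mulr_sumr mulrCA -subrX1 normcM z1 mul1r.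
apply: le_trans (le_normcD _ _) _.
by rewrite normcN normc1 normcX z1 expr1n.
Qed.

End Unimodular.

(** * Frequencies with many near returns *)

Lemma card_le_fibers (T T' : finType) (E : {set T}) (phi : T -> T') (K : nat) :
  (forall v, #|[set e in E | phi e == v]| <= K)%N -> (#|E| <= #|T'| * K)%N.
Proof.
move=> fib; rewrite -sum1_card (partition_big phi predT)//=.
rewrite -sum_nat_const.
apply: leq_sum => v _; apply: leq_trans (fib v).
by rewrite -sum1_card; apply: eq_leq; apply: eq_bigl => e; rewrite inE.
Qed.

Lemma card_le_spread (n q S : nat) (E : {set 'I_n}) : (0 < q)%N ->
  (forall e e', e \in E -> e' \in E -> (e <= e')%N ->
     exists2 s, (s <= S)%N & (e' = e + q * s :> nat)%N) ->
  (#|E| <= S.+1)%N.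
Proof.
move=> q0 spread; have [->|[x xE]] := set_0Vmem E; first by rewrite cards0.
have [e0 e0E min_e0] := @arg_minnP _ x (mem E) (@nat_of_ord n) xE.
pose psi (e : 'I_n) : 'I_S.+1 := inord ((e - e0) %/ q).
rewrite -[S.+1]card_ord -(@card_in_imset _ _ psi) ?max_card// => e e' eE e'E.
have [s sS es] := spread _ _ e0E eE (min_e0 _ eE).
have [s' sS' es'] := spread _ _ e0E e'E (min_e0 _ e'E).
move=> /(congr1 (@nat_of_ord _)); rewrite /psi es es' !addKn !mulKn// !inordK// => ss'.
by apply: val_inj; rewrite /= es es' ss'.
Qed.

(** Pigeonhole on blocks of length [2 * A]: with at most one element per block, [A * #|E|] would be
    at most [n / 2 + A], which is less than [n]. *)
Lemma close_elements (n A : nat) (E : {set 'I_n}) : (0 < A)%N -> (2 * A < n)%N ->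
  (n <= A * #|E|)%N ->
  exists e e', [/\ e \in E, e' \in E, (e < e')%N & (e' - e < 2 * A)%N].
Proof.
move=> A0 An nE; apply/not_existsP => far.
suff : (#|E| <= n %/ (2 * A) + 1)%N.
  by have := leq_divM n (2 * A); nia.
pose psi (e : 'I_n) : 'I_(n %/ (2 * A)).+1 := inord (e %/ (2 * A)).
rewrite addn1 -[X in (_ <= X)%N]card_ord -(@card_in_imset _ _ psi) ?max_card//.
have psiE e : psi e = (e %/ (2 * A))%N :> nat.
  by rewrite inordK// ltnS leq_div2r// ltnW.
move=> e e' eE e'E /(congr1 (@nat_of_ord _)); rewrite !psiE => ee'.
have h := divn_eq e (2 * A); have h' := divn_eq e' (2 * A).
have r := @ltn_pmod e (2 * A) ltac:(lia).
have r' := @ltn_pmod e' (2 * A) ltac:(lia).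
apply: val_inj => /=; case: (ltngtP e e') => // lt.
- by case: (far e); exists e'; split => //; nia.
- by case: (far e'); exists e; split => //; nia.
Qed.

Lemma sub_lt_of_same_block (a r r' u v p : nat) : (r < p)%N -> (r' < p)%N ->
  (u = a + r)%N -> (v = a + r')%N -> (v - u < p)%N.
Proof. by lia. Qed.

(* Within a window on which [w ^+ s], [w = z ^+ q], does not wind around the
   circle, the exponents in a fixed class mod [q] with [z ^+ e] near a given
   point span at most [4 eta / |w - 1|] steps. *)
Lemma return_times_card {R : realType} {z : R[i]} (n q : nat) (eta : R)
    (E : {set 'I_n}) : normc z = 1 -> (0 < q)%N ->
  0 < normc (z ^+ q - 1) <= 2 * eta -> 2 * eta <= 1 ->
  (forall e e', e \in E -> e' \in E -> (e <= e')%N ->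
     normc (z ^+ (e' - e) - 1) <= 2 * eta) ->
  #|E|%:R * normc (z ^+ q - 1) <=
    12 * n%:R * eta * normc (z ^+ q - 1) + 6 * q%:R * eta.
Proof.
move=> z1 q0; set w := z ^+ q; set t := normc (w - 1) => /andP[t0 t2] eta1 ret.
have w1 : normc w = 1 by rewrite normcX z1 expr1n.
have it0 : 0 <= t^-1 by rewrite invr_ge0 ltW.
have s0 : 0 <= 4 * eta / t by rewrite divr_ge0//; lra.
have /andP[TL TU] := truncn_itv it0; have /andP[SL SU] := truncn_itv s0.
(* [T] counts the steps that [w] can make before winding around, and [S] those during which [w ^+ s]
   can stay within [2 * eta] of 1. *)
set T := Num.trunc t^-1 in TL TU; set S := Num.trunc (4 * eta / t) in SL SU.
have T0 : (0 < T)%N.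
  rewrite -ltnS -(@ltr_nat R); apply: le_lt_trans TU.
  by rewrite invf_ge1//; lra.
have Tt : T%:R * t <= 1 by rewrite -ler_pdivlMr// div1r.
have Tt2 : 1 <= 2 * (T%:R * t).
  have : 1 < T.+1%:R * t by rewrite -ltr_pdivrMr// div1r.
  have : T.+1%:R <= 2 * T%:R :> R by rewrite -natrM ler_nat mul2n -addnn -add1n leq_add2r.
  by move=> h1 h2; nra.
have q0' : (0 < q * T)%N by rewrite muln_gt0 q0.
(* A cell is a residue class mod [q] inside a block of length [q * T]. Two elements of a cell differ
   by [q * s] with [s < T], so [s * t / 2 <= |w ^+ s - 1| <= 2 * eta] and [s <= S]. *)
pose phi (e : 'I_n) : 'I_q * 'I_(n %/ (q * T)).+1 :=
  (Ordinal (ltn_pmod e q0), inord (e %/ (q * T))).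
have /card_le_fibers : forall v, (#|[set e in E | phi e == v]| <= S.+1)%N.
  move=> v; apply: (@card_le_spread _ q) => // e e'; rewrite !inE.
  move=> /andP[eE /eqP ev] /andP[e'E /eqP e'v] ee'.
  have : phi e = phi e' by rewrite ev e'v.
  case=> emod /(congr1 (@nat_of_ord _)).
  rewrite !inordK ?ltnS ?leq_div2r 1?ltnW// => ediv.
  have := divn_eq e (q * T); have := divn_eq e' (q * T).
  have := ltn_pmod e q0'; have := ltn_pmod e' q0'.
  rewrite ediv => h1 h2 h3 h4.
  have near := sub_lt_of_same_block _ _ _ _ _ _ h2 h1 h4 h3.
  have : (q %| e' - e)%N by rewrite -eqn_mod_dvd//; apply/eqP.
  case/dvdnP => s es; exists s; last by rewrite mulnC -es subnKC.
  have sT : (s < T)%N by move: near; rewrite es mulnC ltn_pmul2l.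
  have st : s%:R * t <= 1.
    by rewrite (le_trans _ Tt)// ler_wpM2r// ?(ltW t0)// ler_nat ltnW.
  have := normc_unimodularX_sub1_lower w1 _ st.
  have := ret _ _ eE e'E ee'; rewrite es mulnC exprM -/w -/t => r1 r2.
  by rewrite -ltnS -(@ltr_nat R) (le_lt_trans _ SU)// ler_pdivlMr//; lra.
rewrite card_prod !card_ord => cardE.
have : #|E|%:R <= (q * (n %/ (q * T)).+1 * S.+1)%:R :> R by rewrite ler_nat.
(* The number of cells is at most [n / T + q], and [1 / T <= 2 * t]. *)
have cells : (q * (n %/ (q * T)).+1)%:R * T%:R <= n%:R + q%:R * T%:R :> R.
  rewrite -!natrM -natrD ler_nat mulnAC mulnS addnC leq_add2r mulnC.
  exact: leq_divM.
have SUt : S.+1%:R * t <= 6 * eta.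
  have : S%:R * t <= 4 * eta by rewrite -ler_pdivlMr.
  by rewrite -natr1 mulrDl mul1r; lra.
rewrite natrM => cE.
have c0 : 0 <= (q * (n %/ (q * T)).+1)%:R :> R by [].
set c : R := (q * _)%:R in cE cells c0.
have cnt : c <= 2 * n%:R * t + q%:R.
  have n0 : 0 <= n%:R :> R by [].
  have T0r : 0 < T%:R :> R by rewrite ltr0n.
  rewrite -(ler_pM2r T0r); apply: le_trans cells _.
  by rewrite mulrDl lerD2r; nra.
have eta0 : 0 <= eta by lra.
apply: (@le_trans _ _ (c * (S.+1%:R * t))).
  by rewrite mulrA ler_wpM2r// ltW.
apply: (@le_trans _ _ (c * (6 * eta))); first by rewrite ler_wpM2l.
apply: (@le_trans _ _ ((2 * n%:R * t + q%:R) * (6 * eta))).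
  by rewrite ler_wpM2r//; lra.
by lra.
Qed.

(** By averaging, at least [n / A] exponents [e] have a geometric sum of size at least [H / A],
    which puts [z ^ (e - o)] within [eta = 2 * A / H] of 1. Two such exponents at distance
    [q < 2 * A] give [|z ^+ q - 1| <= 2 * eta]. Counting the returns along multiples of [q] then
    gains a further factor of order [n]. *)
Lemma near_rational {R : realType} {z : R[i]} (n A H : nat) (o : int) :
  normc z = 1 -> (0 < A)%N -> (2 * A < n)%N -> (48 * A ^ 2 <= H)%N ->
  2 * n%:R * H%:R <= A%:R *
    \sum_(e < n) normc (\sum_(1 <= m < H.+1) (z ^ (e%:Z - o)) ^+ m) ->
  exists q, [/\ (0 < q)%N, (q < 2 * A)%N &
    normc (z ^+ q - 1) * (n%:R * H%:R) <= 48 * A%:R ^+ 3].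
Proof.
move=> z1 A0 An AH big_sum.
have A0r : 0 < A%:R :> R by rewrite ltr0n.
have H0 : (0 < H)%N by nia.
have H0r : 0 < H%:R :> R by rewrite ltr0n.
have n0r : 0 < n%:R :> R by rewrite ltr0n; lia.
pose g (e : 'I_n) := normc (\sum_(1 <= m < H.+1) (z ^ (e%:Z - o)) ^+ m).
pose E := [set e : 'I_n | H%:R <= A%:R * g e]%SET.
pose eta : R := 2 * A%:R / H%:R.
have etaH : eta * H%:R = 2 * A%:R by rewrite /eta divfK// gt_eqF.
have eta0 : 0 < eta by rewrite divr_gt0// mulr_gt0.
have gH e : g e <= H%:R.
  apply: le_trans (normc_sum _ _ _ _) _.
  rewrite (eq_bigr (fun=> 1)); first by rewrite sumr_const_nat subSS subn0.
  by move=> m _; rewrite normcX normc_unimodularXz// expr1n.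
have nE : (n <= A * #|E|)%N.
  rewrite -(@ler_nat R) natrM -(ler_pM2r H0r).
  have : \sum_(e < n) A%:R * g e <=
      \sum_(e < n) (H%:R + A%:R * ((e \in E)%:R * H%:R)).
    apply: ler_sum => e _; case: (boolP (e \in E)) => [eE|].
      by rewrite mul1r (le_trans (_ : _ <= A%:R * H%:R)) ?lerDr// ler_wpM2l// ltW.
    by rewrite inE -ltNge mul0r mulr0 addr0 => /ltW.
  rewrite -mulr_sumr big_split /= sumr_const card_ord -mulr_sumr -mulr_suml.
  have -> : \sum_(e < n) (e \in E)%:R = #|E|%:R :> R.
    by rewrite -sum1_card natr_sum [RHS]big_mkcond /=; apply: eq_bigr => e _; case: (e \in E).
  by rewrite -mulr_natl; move: big_sum; rewrite /g; lra.
have near e : e \in E -> normc (z ^ (e%:Z - o) - 1) <= eta.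
  rewrite inE => eE; have u1 := normc_unimodularXz z1 (e%:Z - o).
  have := geometric_sum_upper u1 H; rewrite -/(g e) => gt2.
  rewrite -(ler_pM2r H0r) etaH mulrC.
  apply: le_trans (ler_wpM2r (normc_ge0 _) eE) _.
  by rewrite -mulrA [leRHS]mulrC ler_wpM2l// ltW.
have ret e e' : e \in E -> e' \in E -> (e <= e')%N ->
    normc (z ^+ (e' - e) - 1) <= 2 * eta.
  move=> eE e'E ee'.
  have -> : z ^+ (e' - e) - 1 =
     (z ^ (e%:Z - o))^-1 * ((z ^ (e'%:Z - o) - 1) - (z ^ (e%:Z - o) - 1)).
    have -> (a b : R[i]) : (a - 1) - (b - 1) = a - b by ring.
    rewrite mulrBr mulVf ?expfz_neq0 ?unimodular_neq0//; congr (_ - _).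
    rewrite invr_expz -expfzDr ?unimodular_neq0// exprnP -subzn//.
    by congr (_ ^ _); ring.
  rewrite normcM normcV normc_unimodularXz// invr1 mul1r.
  apply: le_trans (le_normcD _ _) _; rewrite normcN.
  by have := near _ eE; have := near _ e'E; lra.
have [e [e' [eE e'E ee' e'e]]] := close_elements _ _ _ A0 An nE.
exists (e' - e)%N; split => //; first by rewrite subn_gt0.
set q := (e' - e)%N in e'e *; have q0 : (0 < q)%N by rewrite subn_gt0.
set t := normc _.
have t2 : t <= 2 * eta by apply: ret => //; exact: ltnW.
have [t0|t0] := leP t 0.
  apply: (@le_trans _ _ 0); last by rewrite mulr_ge0// exprn_ge0// ltW.
  by rewrite mulr_le0_ge0// mulr_ge0// ltW.
have AHr : 48 * A%:R ^+ 2 <= H%:R :> R by rewrite -natrX -natrM ler_nat.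
have A1 : 1 <= A%:R :> R by rewrite ler1n.
have etaA : 24 * A%:R * eta <= 1.
  rewrite -(ler_pM2r H0r) -[_ * eta * _]mulrA etaH mul1r; apply: le_trans AHr.
  by lra.
have eta1 : 2 * eta <= 1 by nra.
have := return_times_card _ _ _ _ z1 q0 _ eta1 ret.
rewrite -/t t0 t2 => /(_ isT) cardE.
have nEr : n%:R <= A%:R * #|E|%:R :> R by rewrite -natrM ler_nat.
have qA : q%:R <= 2 * A%:R :> R by rewrite -natrM ler_nat ltnW.
have nt0 : 0 <= n%:R * t by rewrite mulr_ge0// ltW.
(* The density of [E] is played against the count of returns. As [24 * A * eta <= 1], the term with
   [n * eta * t] is at most half of the left side and gets absorbed. *)
have step1 : n%:R * t <= A%:R * (12 * n%:R * eta * t + 6 * q%:R * eta).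
  apply: le_trans (_ : A%:R * (#|E|%:R * t) <= _); last by rewrite ler_wpM2l// ltW.
  by rewrite mulrA ler_wpM2r// ltW.
have step2 : n%:R * t <= 24 * A%:R ^+ 2 * eta.
  have h1 : 24 * A%:R * eta * (n%:R * t) <= n%:R * t by rewrite ler_piMl.
  have h2 : A%:R * eta * q%:R <= A%:R * eta * (2 * A%:R).
    by rewrite ler_wpM2l// mulr_ge0// ltW.
  by lra.
rewrite mulrCA mulrA -[leRHS]/(48 * A%:R ^+ 3).
have := ler_wpM2r (ltW H0r) step2; rewrite -[_ * eta * _]mulrA etaH.
by lra.
Qed.

(** * Parseval for sums of translates *)

(** In characteristic 0 the polynomial [X^n - 1] is separable, so it has [n] distinct roots, and [n]
    distinct [n]-th roots of unity include a primitive one. *)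
Lemma primitive_root_exists (F : numClosedFieldType) (n : nat) : (0 < n)%N ->
  exists z : F, n.-primitive_root z.
Proof.
move=> n0; have [r] := closed_field_poly_normal ('X^n - 1 : {poly F}).
rewrite (monicP (monicXnsubC 1 n0)) scale1r => XnE.
have r1 : all n.-unity_root r.
  by apply/allP => z; rewrite -root_prod_XsubC -XnE.
have size_r : size r = n.
  by apply/succn_inj; rewrite -(size_prod_XsubC r id) -XnE size_XnsubC.
have uniq_r : uniq r.
  by rewrite -separable_prod_XsubC -XnE separable_Xn_sub_1// pnatr_eq0 -lt0n.
have /hasP[z _ zP] : has n.-primitive_root r.
  by apply: has_prim_root => //; rewrite size_r.
by exists z.
Qed.

(** The interval from [-W] to [W], a full set of residues mod [2 * W + 1]; it serves both as a
    summation range and as the cyclic group for Parseval. *)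
Definition window (W : nat) : seq int := [seq i%:Z - W%:Z | i <- iota 0 W.*2.+1].

Lemma size_window W : size (window W) = W.*2.+1.
Proof. by rewrite size_map size_iota. Qed.

Lemma window_uniq W : uniq (window W).
Proof. by rewrite map_inj_uniq ?iota_uniq// => i j; lia. Qed.

Lemma mem_window W (x : int) : (x \in window W) = (`|x| <= W)%N.
Proof.
apply/mapP/idP => [[n]|xW]; first by rewrite mem_iota => nW ->; lia.
exists (absz (x + W%:Z)); first by rewrite mem_iota; lia.
by lia.
Qed.

Section Spectrum.
Context {R : realType}.
Implicit Types f g : int -> R[i].

Lemma fsum_window g W : (forall x, g x <> 0 -> (`|x| <= W)%N) ->
  \sum_(x \in [set: int]) g x = \sum_(x <- window W) g x.
Proof.
move=> gW; rewrite [RHS]fsbig_seq ?window_uniq//; apply/esym; apply: fsbig_widen => // x [_] /=.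
by rewrite mem_window => xW; apply: contrapT => /gW.
Qed.

(** The translate of the support stays in the window, so both sides are sums over all integers. *)
Lemma window_shift g W (a : int) : (forall x, g x <> 0 -> (`|x| + `|a| <= W)%N) ->
  \sum_(x <- window W) g (x + a) = \sum_(x <- window W) g x.
Proof.
move=> gW; rewrite -!fsum_window; last 2 first.
- by move=> x /gW; lia.
- by move=> x /gW; lia.
apply/esym/(reindex_fsbigT (fun x => x + a)).
by exists (fun x => x - a) => x; rewrite ?addrK ?subrK.
Qed.

Lemma sum_roots_of_unity {M : nat} {z : R[i]} (h : int) :
  M.-primitive_root z -> (`|h| < M)%N ->
  \sum_(j < M) (z ^+ j) ^ h = M%:R * (h == 0)%:R.
Proof.
move=> zM hM; have [->|h0] := eqVneq h 0.
  rewrite (eq_bigr (fun=> 1)) => [|j _]; last by rewrite expr0z.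
  by rewrite sumr_const card_ord mulr1.
rewrite mulr0; have z0 : z != 0.
  apply/eqP => z0; have := prim_expr_order zM.
  rewrite z0 expr0n eqn0Ngt (leq_ltn_trans _ hM)// => /eqP.
  by rewrite eq_sym oner_eq0.
have zh1 : z ^ h - 1 != 0.
  rewrite subr_eq0; apply/negP => /eqP zh1.
  have : z ^+ `|h| = 1.
    by case: (h) zh1 => n; rewrite ?NegzE -?exprnN//= => /(congr1 GRing.inv); rewrite invrK invr1.
  move/eqP; rewrite -(prim_order_dvd zM) => /dvdn_leq.
  by rewrite absz_gt0 h0 leqNgt hM => /(_ isT).
apply: (mulfI zh1); rewrite mulr0.
rewrite (eq_bigr (fun j : 'I_M => (z ^ h) ^+ j)); last first.
  by move=> j _; rewrite !exprnP !exprz_exp mulrC.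
rewrite -subrX1 exprnP exprz_exp mulrC -exprz_exp.
by rewrite -exprnP (prim_expr_order zM) exp1rz subrr.
Qed.

Definition fourier f W (w : R[i]) : R[i] := \sum_(x <- window W) f x * w ^ (- x).

Lemma parseval g W {z : R[i]} : W.*2.+1.-primitive_root z -> normc z = 1 ->
  \sum_(j < W.*2.+1) normc (fourier g W (z ^+ j)) ^+ 2 =
    W.*2.+1%:R * \sum_(x <- window W) normc (g x) ^+ 2.
Proof.
move=> zM z1; have u1 j : normc (z ^+ j) = 1 by rewrite normcX z1 expr1n.
apply: (@fmorph_inj _ _ (real_complex R)).
rewrite rmorphM rmorph_nat !rmorph_sum /= mulr_sumr.
transitivity (\sum_(x <- window W) \sum_(y <- window W)
    g x * (g y)^*%C * \sum_(j < W.*2.+1) (z ^+ j) ^ (y - x)).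
  under eq_bigr => j _.
    rewrite sqr_normcE /fourier rmorph_sum mulr_suml.
    under eq_bigr => x _.
      rewrite mulr_sumr.
      under eq_bigr => y _.
        rewrite rmorphM /= conj_unimodularXz// opprK mulrACA.
        rewrite -expfzDr ?(unimodular_neq0 (u1 j))// (addrC (- x)).
        over.
      over.
    over.
  rewrite exchange_big /=; apply: eq_bigr => x _.
  rewrite exchange_big /=; apply: eq_bigr => y _.
  by rewrite mulr_sumr.
rewrite big_seq [RHS]big_seq; apply: eq_bigr => x xW.
rewrite (bigD1_seq x) ?window_uniq//= subrr sum_roots_of_unity// eqxx mulr1.
rewrite big_seq_cond big1 => [|y /andP[yW yx]]; first by rewrite addr0 mulrC sqr_normcE.
(* Two points of the window differ by at most [2 * W], which is below the modulus, so only the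
   diagonal survives. *)
rewrite sum_roots_of_unity// ?subr_eq0 ?(negPf yx) ?mulr0//.
by move: xW yW; rewrite !mem_window; lia.
Qed.

(** Translation turns into multiplication by a character. The margin [|a s| + U <= W] keeps each
    translate inside the window. *)
Lemma fourier_translates f U W (w : R[i]) S (c : 'I_S -> R[i]) (a : 'I_S -> int) :
  normc w = 1 -> (forall x, f x <> 0 -> (`|x| <= U)%N) ->
  (forall s, `|a s| + U <= W)%N ->
  fourier (fun x => \sum_s c s * f (x + a s)) W w =
    fourier f W w * \sum_s c s * w ^ a s.
Proof.
move=> w1 fU aW; rewrite /fourier.
under eq_bigr do rewrite mulr_suml.
rewrite exchange_big mulr_sumr; apply: eq_bigr => s _.
rewrite -(window_shift (fun x => f x * w ^ - x) W (a s)); last first.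
  move=> x; have [->|/eqP fx _] := eqVneq (f x) 0; first by rewrite mul0r.
  by have := fU _ fx; have := aW s; lia.
rewrite mulr_suml; apply: eq_bigr => x _.
have -> : w ^ (- x) = w ^ (- (x + a s)) * w ^ a s; last by ring.
by rewrite -expfzDr ?unimodular_neq0// opprD addrNK.
Qed.

(* Parseval on a cyclic group too large for the translates to wrap around; the
   [w j] are its characters evaluated at the generator and [p j = |f^(j)|^2 / M]. *)
Lemma translates_spectrum f U W : (forall x, f x <> 0 -> (`|x| <= U)%N) ->
  exists (M : nat) (p : 'I_M -> R) (w : 'I_M -> R[i]),
  [/\ forall j, 0 <= p j, forall j, normc (w j) = 1 &
    forall S (c : 'I_S -> R[i]) (a : 'I_S -> int), (forall s, `|a s| + U <= W)%N ->
      \sum_(x <- window W) normc (\sum_s c s * f (x + a s)) ^+ 2 =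
      \sum_j p j * normc (\sum_s c s * w j ^ a s) ^+ 2].
Proof.
move=> fU; have [z zM] := @primitive_root_exists R[i] W.*2.+1 isT.
have z1 : normc z = 1.
  apply/eqP; rewrite -(@pexpr_eq1 _ _ W.*2.+1) ?normc_ge0//.
  by rewrite -normcX (prim_expr_order zM) normc1.
have u1 j : normc (z ^+ j) = 1 by rewrite normcX z1 expr1n.
exists W.*2.+1, (fun j => normc (fourier f W (z ^+ j)) ^+ 2 / W.*2.+1%:R),
  (fun j => z ^+ j); split => //.
  by move=> j; rewrite divr_ge0// exprn_ge0// normc_ge0.
move=> S c a aW; have M0 : W.*2.+1%:R != 0 :> R by rewrite pnatr_eq0.
apply: (mulfI M0); rewrite -(parseval _ _ zM z1) mulr_sumr.
apply: eq_bigr => j _; rewrite (fourier_translates _ _ _ _ _ _ _ (u1 j) fU aW).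
by rewrite normcM exprMn [RHS]mulrA [X in _ = X * _]mulrCA divff// mulr1.
Qed.

End Spectrum.

(** * Progressions from large energy *)

(** Vanishing terms at either end are trimmed, by induction on [L], until both endpoints lie in the
    support. Everything between them is then in the initial segment, and the sum has not changed. *)
Lemma fsum_progression (R : realType) (f : int -> R[i]) (N : R) (q L : nat)
    (x : int) : supported_on f (initial_segment N) -> (0 < q)%N ->
  \sum_(n < L) f (x + (q * n)%:Z) != 0 ->
  exists2 P, arith_progression P /\ P `<=` initial_segment N &
    \sum_(y \in P) f y = \sum_(n < L) f (x + (q * n)%:Z).
Proof.
move=> supp q0; elim: L x => [|L IH] x; first by rewrite big_ord0 eqxx.
have [fx0|/eqP/supp fx] := eqVneq (f x) 0.
  rewrite big_ord_recl /= muln0 addr0 fx0 add0r.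
  have -> : \sum_(n < L) f (x + (q * bump 0 n)%:Z) =
      \sum_(n < L) f (x + q%:Z + (q * n)%:Z).
    by apply: eq_bigr => n _; rewrite -addrA -PoszD -mulnS.
  exact: IH.
have [fy0|/eqP/supp fy _] := eqVneq (f (x + (q * L)%:Z)) 0.
  by rewrite big_ord_recr /= fy0 addr0; exact: IH.
exists [set x + q%:Z * n%:Z | n in `I_L.+1].
  split; first by exists x, q%:Z, L.+1.
  move=> _ [n /= nL <-]; move: fx fy; rewrite /initial_segment /= ltnS in nL *.
  by move=> /andP[x1 _] /andP[_ yN]; nia.
rewrite fsbig_image; last first.
  move=> m n _ _ /addrI /mulfI; rewrite eqz_nat -lt0n q0 => /(_ isT) [].
  by [].
by rewrite -fsbig_ord; apply: eq_bigr => n _; rewrite PoszM.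
Qed.

Lemma U1plus_norm_ge (R : realType) (f : int -> R[i]) (N : R) (q L : nat)
    (x : int) : 1 <= N -> supported_on f (initial_segment N) -> (0 < q)%N ->
  normc (\sum_(n < L) f (x + (q * n)%:Z)) / N <= U1plus_norm N f.
Proof.
move=> N1 supp q0; have N0 : 0 < N by rewrite (lt_le_trans _ N1).
have [s1 sub] := progression_sums_max f N1.
rewrite /U1plus_norm; move: (card_initial_segment N1).
set n := (X in Posz X = _) => cardE.
have n0 : 0 < n%:R :> R by rewrite ltr0n -ltz_nat cardE floor_gt0.
have nN : n%:R <= N by rewrite -[_%:R]/(n%:Z%:~R) cardE floor_le.
have sup0 : 0 <= sup (progression_sums N f).
  by case: s1 => P _ <-; exact: normc_ge0.
have [->|S0] := eqVneq (\sum_(n < L) f (x + (q * n)%:Z)) 0.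
  by rewrite normc0 mul0r mulr_ge0// invr_ge0 ltW.
have [P PN fP] := fsum_progression _ _ _ _ _ _ supp q0 S0.
rewrite -fP mulrC ler_pM ?invr_ge0 ?normc_ge0 ?(ltW N0)//.
  by rewrite lef_pV2 ?posrE.
by apply: sub; exists P.
Qed.

Lemma exists_ge_average (R : realType) (I : eqType) (s : seq I) (F : I -> R) :
  (0 < size s)%N -> exists2 x, x \in s & \sum_(y <- s) F y <= (size s)%:R * F x.
Proof.
elim: s => // a [|b s] IH _.
  by exists a; rewrite ?mem_head// big_seq1 mul1r.
have [//|x xs avg] := IH.
have sizeE : (size [:: a, b & s])%:R = 1 + (size (b :: s))%:R :> R by rewrite nat1r.
rewrite sizeE.
have [ax|/ltW xa] := leP (F a) (F x).
  exists x; first by rewrite inE xs orbT.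
  by rewrite mulrDl mul1r big_cons lerD.
exists a; first exact: mem_head.
rewrite mulrDl mul1r big_cons lerD//.
by apply: le_trans avg _; rewrite ler_wpM2l.
Qed.

Lemma sum_shift_le (R : realType) (g : nat -> R) (a s b : nat) :
  (forall i, 0 <= g i) -> (s + a <= b)%N ->
  \sum_(t < a) g (t + s)%N <= \sum_(e < b) g e.
Proof.
move=> g0 sab; rewrite -(big_mkord xpredT g) -(big_mkord xpredT (fun t => g (t + s)%N)).
have -> : \sum_(0 <= t < a) g (t + s)%N = \sum_(s <= e < s + a) g e.
  by rewrite -{1}(addKn s a) -(big_addn 0 _ _ xpredT) add0n.
have sb : (s <= b)%N by rewrite (leq_trans _ sab)// leq_addr.
rewrite (big_cat_nat (leq0n s) sb) (big_cat_nat (leq_addr a s) sab) /=.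
by rewrite addrCA lerDl addr_ge0// sumr_ge0.
Qed.

Section Energy.
Context {R : realType}.

Lemma sqr_normc_sum (I : finType) (F : I -> R[i]) :
  ((normc (\sum_t F t) ^+ 2)%:C)%C = \sum_t' \sum_t F t * ((F t')^*)%C.
Proof.
rewrite sqr_normcE rmorph_sum mulr_sumr; apply: eq_bigr => t' _.
by rewrite mulr_suml.
Qed.

(* Squaring out, the phases [c] survive only through [|c t| <= 1], and each
   difference [t - t'] is hit at most once for fixed [t']. *)
Lemma phase_sum_le {w : R[i]} (D H : nat) (c : 'I_(2 * D).+1 -> R[i]) :
  normc w = 1 -> (forall t, normc (c t) <= 1) ->
  \sum_(1 <= m < H.+1) normc (\sum_t c t * w ^ ((t%:Z - D%:Z) * m%:Z)) ^+ 2 <=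
  (2 * D).+1%:R * \sum_(e < (4 * D).+1)
    normc (\sum_(1 <= m < H.+1) (w ^ (e%:Z - (2 * D)%:Z)) ^+ m).
Proof.
move=> w1 c1; set Sigma := \sum_(1 <= m < H.+1) _.
pose g (e : nat) := normc (\sum_(1 <= m < H.+1) (w ^ (e%:Z - (2 * D)%:Z)) ^+ m).
have Sigma0 : 0 <= Sigma by apply: sumr_ge0 => m _; rewrite exprn_ge0// normc_ge0.
have -> : Sigma = normc (Sigma%:C)%C by rewrite /= expr0n /= addr0 sqrtr_sqr ger0_norm.
have -> : (Sigma%:C)%C = \sum_(t' < (2 * D).+1) \sum_(t < (2 * D).+1)
    c t * (c t')^*%C *
    \sum_(1 <= m < H.+1) (w ^ ((t + (2 * D - t'))%N%:Z - (2 * D)%:Z)) ^+ m.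
  rewrite /Sigma rmorph_sum /=.
  under eq_bigr => m _.
    rewrite sqr_normc_sum.
    under eq_bigr => t' _.
      under eq_bigr => t _.
        rewrite rmorphM /= conj_unimodularXz// mulrACA.
        rewrite -expfzDr ?(unimodular_neq0 w1)//.
        have -> : (t%:Z - D%:Z) * m%:Z + - ((t'%:Z - D%:Z) * m%:Z) =
            ((t + (2 * D - t'))%N%:Z - (2 * D)%:Z) * m%:Z.
          by have := ltn_ord t'; rewrite ltnS => ?; rewrite PoszD -subzn//; ring.
        rewrite -exprz_exp -exprnP.
        over.
      over.
    over.
  rewrite exchange_big /=; apply: eq_bigr => t' _.
  by rewrite exchange_big /=; apply: eq_bigr => t _; rewrite mulr_sumr.
apply: le_trans (normc_sum _ _ _ _) _.
rewrite -[X in X%:R](card_ord (2 * D).+1) mulr_natl -sumr_const.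
apply: ler_sum => t' _; apply: le_trans (normc_sum _ _ _ _) _.
apply: (@le_trans _ _ (\sum_(t < (2 * D).+1) g (t + (2 * D - t'))%N)).
  apply: ler_sum => t _; rewrite !normcM normc_conj.
  by rewrite ler_piMl ?normc_ge0// mulr_ile1 ?normc_ge0.
by apply: sum_shift_le => [e|]; [exact: normc_ge0 | lia].
Qed.

Lemma sum_sqr_window_le (f : int -> R[i]) (N W : nat) : one_bounded f ->
  (forall x, f x <> 0 -> 1 <= x <= N%:Z) ->
  \sum_(x <- window W) normc (f x) ^+ 2 <= N%:R.
Proof.
move=> f1 supp.
apply: (@le_trans _ _ (\sum_(x <- window W | (1 <= x <= N%:Z)%R) 1)%N%:R).
  rewrite natr_sum [leRHS]big_mkcond; apply: ler_sum => x _; case: ifPn => [_|xN].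
    by rewrite exprn_ile1 ?normc_ge0.
  have -> : f x = 0 by apply: contrapT => /supp; apply/negP.
  by rewrite normc0 expr0n.
rewrite ler_nat sum1_count -size_filter.
rewrite -[N in (_ <= N)%N](size_iota 1) -(size_map Posz).
apply: uniq_leq_size => [|x]; first by rewrite filter_uniq// window_uniq.
rewrite mem_filter => /andP[xN _]; apply/mapP; exists `|x|%N; last by lia.
by rewrite mem_iota; lia.
Qed.

(** In the spectral form of the energy, frequencies with large [G j] carry mass at least
    [2 * N / A]. Each of them has a step [q < 2 * A] along which length-[L] sums do not cancel, and
    the same spectral identity, read for translates by [q * l], returns to sums of [f]. *)
Lemma progression_of_large_energy (f : int -> R[i]) (N D H A L W : nat)
    (c : 'I_(2 * D).+1 -> R[i]) :
  one_bounded f -> (forall x, f x <> 0 -> 1 <= x <= N%:Z) ->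
  (forall t, normc (c t) <= 1) ->
  (0 < A)%N -> (0 < L)%N -> (2 * A < (4 * D).+1)%N -> (48 * A ^ 2 <= H)%N ->
  (2 * A * L <= N)%N -> (48 * A ^ 3 * L <= (4 * D).+1 * H)%N ->
  W = (2 * N + D * H)%N ->
  4 * (2 * D).+1%:R * ((4 * D).+1 * H * N)%:R <= A%:R *
    \sum_(1 <= m < H.+1) \sum_(x <- window W)
      normc (\sum_t c t * f (x + (t%:Z - D%:Z) * m%:Z)) ^+ 2 ->
  exists (q : nat) (x : int), (0 < q)%N /\
    (L * N)%:R <= (4 * A ^ 2 * W.*2.+1)%:R *
      normc (\sum_(n < L) f (x + (q * n)%:Z)).
Proof.
move=> f1 supp c1 A0 L0 AD AH AL AL' WE; set n := (4 * D).+1 in AD AL' *.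
have fU x : f x <> 0 -> (`|x| <= N)%N by move/supp; lia.
have [M [p [w [p0 w1 spec]]]] := translates_spectrum f N W fU.
pose G j := \sum_(e < n) normc (\sum_(1 <= m < H.+1) (w j ^ (e%:Z - (2 * D)%:Z)) ^+ m).
have A0r : 0 < A%:R :> R by rewrite ltr0n.
have H0r : 0 < H%:R :> R by rewrite ltr0n; nia.
have n0r : 0 < n%:R :> R by rewrite ltr0n.
have L0r : 0 < L%:R :> R by rewrite ltr0n.
have N0r : 0 < N%:R :> R by rewrite ltr0n; nia.
(* A single untranslated term in [spec] identifies the total mass with the sum of [|f|^2]. *)
have sum_p : \sum_j p j <= N%:R.
  apply: le_trans (sum_sqr_window_le _ _ W f1 supp).
  have := spec 1%N (fun=> 1) (fun=> 0).
  under eq_bigr do rewrite big_ord1 mul1r addr0.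
  move=> ->; last by move=> _; lia.
  by apply: ler_sum => j _; rewrite big_ord1 mul1r expr0z normc1 expr1n mulr1.
have GnH j : G j <= n%:R * H%:R.
  apply: (@le_trans _ _ (\sum_(e < n) H%:R)); last first.
    by rewrite sumr_const card_ord mulr_natl.
  apply: ler_sum => e _; apply: le_trans (normc_sum _ _ _ _) _.
  rewrite (eq_bigr (fun=> 1)); first by rewrite sumr_const_nat subSS subn0.
  by move=> m _; rewrite normcX normc_unimodularXz// expr1n.
move=> large; have {}large : 4 * (n%:R * H%:R * N%:R) <= A%:R * \sum_j p j * G j.
  have D0 : 0 < (2 * D).+1%:R :> R by [].
  rewrite -(ler_pM2l D0).
  apply: (@le_trans _ _ (4 * (2 * D).+1%:R * (n * H * N)%:R)).
    by rewrite !natrM; lra.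
  apply: le_trans large _; rewrite [leRHS]mulrCA ler_wpM2l//.
  rewrite (eq_big_nat _ _ (F2 := fun m => \sum_j p j *
      normc (\sum_t c t * w j ^ ((t%:Z - D%:Z) * m%:Z)) ^+ 2)); last first.
    move=> m /andP[m1 mH]; apply: spec => t; have := ltn_ord t.
    by rewrite WE abszM /=; nia.
  rewrite exchange_big mulr_sumr; apply: ler_sum => j _.
  by rewrite -mulr_sumr mulrCA ler_wpM2l// phase_sum_le.
pose good j := 2 * n%:R * H%:R <= A%:R * G j.
(* The bad frequencies contribute at most [2 * n * H * N], half of the lower bound in [large]; on
   good ones [G j <= n * H]. *)
have mass : 2 * N%:R <= A%:R * \sum_(j | good j) p j.
  have nH0 : 0 < n%:R * H%:R :> R by rewrite mulr_gt0.
  have : A%:R * \sum_j p j * G j <=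
      \sum_j (2 * (n%:R * H%:R) * p j + A%:R * (n%:R * H%:R) * (if good j then p j else 0)).
    rewrite mulr_sumr; apply: ler_sum => j _; rewrite mulrCA.
    case: ifPn => [_|bad].
      apply: (@le_trans _ _ (p j * (A%:R * (n%:R * H%:R)))).
        by rewrite ler_wpM2l// ler_wpM2l// ltW.
      by rewrite [leLHS]mulrC lerDr mulr_ge0// mulr_ge0// ltW.
    rewrite mulr0 addr0 mulrC ler_wpM2r//.
    by move: bad; rewrite /good -ltNge mulrA => /ltW.
  rewrite big_split -!mulr_sumr -big_mkcond /=; set P := \sum_(j | good j) p j.
  move=> h; rewrite -(ler_pM2l nH0).
  have : 2 * (n%:R * H%:R) * \sum_j p j <= 2 * (n%:R * H%:R) * N%:R.
    by rewrite ler_wpM2l// mulr_ge0// ltW.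
  by move: h large; lra.
have qI q : (q \in iota 1 (2 * A).-1) = (0 < q < 2 * A)%N.
  by rewrite mem_iota add1n prednK// muln_gt0.
pose T (q : nat) (x : int) := normc (\sum_(l < L) f (x + (q * l)%:Z)).
have energy q : (q < 2 * A)%N -> \sum_(x <- window W) T q x ^+ 2 =
    \sum_j p j * normc (\sum_(l < L) (w j ^+ q) ^+ l) ^+ 2.
  move=> qA; have := spec L (fun=> 1) (fun l => (q * l)%:Z).
  under eq_bigr do under eq_bigr do rewrite mul1r.
  move=> ->; last by move=> l; have := ltn_ord l; rewrite WE /=; nia.
  apply: eq_bigr => j _; congr (_ * normc _ ^+ 2).
  by apply: eq_bigr => l _; rewrite mul1r -exprM.
(* A good [w j] has some [q] with [|w j ^+ q - 1| <= 1 / L], hence a geometric sum of modulus at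
   least [L / 2]. As [q] varies with [j], the energies of all admissible [q] are added. *)
have total : L%:R ^+ 2 / 4 * \sum_(j | good j) p j <=
    \sum_(q <- iota 1 (2 * A).-1) \sum_(x <- window W) T q x ^+ 2.
  rewrite (eq_big_seq (fun q => \sum_j p j *
      normc (\sum_(l < L) (w j ^+ q) ^+ l) ^+ 2)); last first.
    by move=> q; rewrite qI => /andP[_ qA]; exact: energy.
  rewrite exchange_big mulr_sumr big_mkcond /=.
  apply: ler_sum => j _; rewrite -mulr_sumr mulrC.
  case: ifPn => [gj|_]; last first.
    by rewrite mulr_ge0// sumr_ge0// => q _; rewrite exprn_ge0// normc_ge0.
  have [q [q0 qA near]] := near_rational _ _ _ _ (w1 j) A0 AD AH gj.
  rewrite ler_wpM2l//.
  rewrite (bigD1_seq q)/= ?iota_uniq ?qI ?q0//.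
  apply: ler_wpDr.
    by rewrite sumr_ge0// => q' _; rewrite exprn_ge0// normc_ge0.
  have wq1 : normc (w j ^+ q) = 1 by rewrite normcX w1 expr1n.
  have : L%:R / 2 <= normc (\sum_(l < L) (w j ^+ q) ^+ l).
    apply: geometric_sum_lower => //.
    have ALr : 48 * A%:R ^+ 3 * L%:R <= n%:R * H%:R :> R.
      by rewrite -natrX -!natrM ler_nat.
    rewrite -(@ler_pM2r _ (n%:R * H%:R)) ?mulr_gt0// mul1r -mulrA.
    by apply: le_trans ALr; rewrite [leRHS]mulrC ler_wpM2l// ltW.
  move=> Lle; have -> : L%:R ^+ 2 / 4 = (L%:R / 2) ^+ 2 :> R by field.
  by rewrite lerXn2r ?nnegrE ?normc_ge0// divr_ge0// ltW.
(* Pigeonholing over [q] costs a factor below [2 * A], and over [x] the size of the window. *)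
have [|q q_iota avg_q] := @exists_ge_average R _ (iota 1 (2 * A).-1)
  (fun q => \sum_(x <- window W) T q x ^+ 2); first by rewrite size_iota; clear -A0; lia.
have [|x _ avg_x] := @exists_ge_average R _ (window W) (fun x => T q x ^+ 2).
  by rewrite size_window.
exists q, x; split; first by move: q_iota; rewrite qI => /andP[].
rewrite -/(T q x).
rewrite size_iota in avg_q; rewrite size_window in avg_x.
have TL : T q x <= L%:R.
  apply: le_trans (normc_sum _ _ _ _) _.
  apply: (@le_trans _ _ (\sum_(l < L) 1)); first by apply: ler_sum => l _; exact: f1.
  by rewrite sumr_const card_ord.
have T0 : 0 <= T q x by exact: normc_ge0.
(* Bounding one factor by [L] turns the second moment into the first power wanted. *)
have T2 : T q x ^+ 2 <= L%:R * T q x by rewrite expr2 ler_wpM2r.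
have AA : (2 * A).-1%:R <= 2 * A%:R :> R by rewrite -natrM ler_nat leq_pred.
rewrite -(ler_pM2l L0r) !natrM ?natrX.
have W0 : 0 <= W.*2.+1%:R :> R by [].
set V := W.*2.+1%:R in avg_x W0 *; set P := \sum_(j | good j) p j in mass total.
set X := \sum_(x <- window W) T q x ^+ 2 in avg_q avg_x.
have X1 : X <= V * (L%:R * T q x) by apply: le_trans avg_x _; rewrite ler_wpM2l.
have X0 : 0 <= X by apply: sumr_ge0 => y _; rewrite sqr_ge0.
have X2 : L%:R ^+ 2 / 4 * P <= 2 * A%:R * (V * (L%:R * T q x)).
  apply: le_trans total _; apply: le_trans avg_q _.
  apply: le_trans (_ : 2 * A%:R * X <= _); first by rewrite ler_wpM2r.
  by rewrite ler_wpM2l// mulr_ge0// ltW.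
have X3 : L%:R ^+ 2 * (2 * N%:R) <= L%:R ^+ 2 * (A%:R * P).
  by rewrite ler_wpM2l// sqr_ge0.
have := ler_wpM2l (ltW A0r) X2.
by move: X3; lra.
Qed.

End Energy.

(** * From the counting operator to the energy *)

(** Cauchy-Schwarz against the constant 1, read off from the nonnegative sum of
    [(n * a x - S)^2]. *)
Lemma sqr_sum_le (R : realFieldType) (I : Type) (s : seq I) (a : I -> R) :
  (\sum_(x <- s) a x) ^+ 2 <= (size s)%:R * \sum_(x <- s) a x ^+ 2.
Proof.
set S := \sum_(x <- s) a x; set Q := \sum_(x <- s) a x ^+ 2; set n := size s.
have [s0|n0] := posnP n.
  by rewrite /S (size0nil s0) big_nil expr0n /= mulr_ge0// sumr_ge0// => x _; rewrite sqr_ge0.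
have n0r : 0 < n%:R :> R by rewrite ltr0n.
have : 0 <= \sum_(x <- s) (n%:R * a x - S) ^+ 2.
  by apply: sumr_ge0 => x _; rewrite sqr_ge0.
have -> : \sum_(x <- s) (n%:R * a x - S) ^+ 2 = n%:R * (n%:R * Q - S ^+ 2).
  have sqrE x : (n%:R * a x - S) ^+ 2 =
      n%:R ^+ 2 * a x ^+ 2 - 2 * n%:R * S * a x + S ^+ 2 by ring.
  under eq_bigr do rewrite sqrE.
  rewrite big_split sumrB /= -!mulr_sumr big_const_seq count_predT iter_addr_0.
  by rewrite -/S -/Q -/n -[_ *+ n]mulr_natl; ring.
by rewrite pmulr_rge0// subr_ge0.
Qed.

Section Reduction.
Context {R : realType} {k : nat}.

Definition update_coord {n} (b : {ffun 'I_k -> 'I_n}) (i : 'I_k) (t : 'I_n) :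
  {ffun 'I_k -> 'I_n} := [ffun j => if j == i then t else b j].

Lemma exists_heavy_line (n : nat) (G : {ffun 'I_k -> 'I_n.+1} -> R) (i : 'I_k) :
  exists b, n.+1%:R * \sum_b' G b' <= n.+1%:R ^+ k * \sum_t G (update_coord b i t).
Proof.
have size_enum : size (enum {ffun 'I_k -> 'I_n.+1}) = (n.+1 ^ k)%N.
  by rewrite -cardE card_ffun !card_ord.
have [|b _] := exists_ge_average R _
    (enum {ffun 'I_k -> 'I_n.+1}) (fun b => \sum_t G (update_coord b i t)).
  by rewrite size_enum expn_gt0.
rewrite size_enum natrX big_enum /= => avg.
exists b; apply: le_trans avg.
rewrite pair_big /=.
(* Exchanging the new value [t] with the old coordinate is an involution; after it each point is
   counted [n + 1] times. *)
rewrite (reindex_inj (h := fun p => (update_coord p.1 i p.2, p.1 i))) /=; last first.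
  apply: (can_inj (g := fun p => (update_coord p.1 i p.2, p.1 i))) => -[b' t] /=.
  congr pair; last by rewrite ffunE eqxx.
  by apply/ffunP => j; rewrite !ffunE; case: eqP => // ->.
rewrite (eq_bigr (fun p => G p.1)) => [|[b' t] _ /=]; last first.
  by congr G; apply/ffunP => j; rewrite !ffunE; case: eqP => // ->.
rewrite -(pair_big xpredT xpredT (fun b _ => G b)) /= mulr_sumr.
apply: ler_sum => b' _; rewrite sumr_const card_ord mulr_natl.
by [].
Qed.

(** The inner sum of the counting operator at one [b]; the index [b i] encodes the integer [b i - D]
    between [-D] and [D]. *)
Definition slice (H D W : nat) (f : 'I_k -> int -> R[i])
    (b : {ffun 'I_k -> 'I_(2 * D).+1}) : R[i] :=
  \sum_(x <- window W) \sum_(1 <= m < H.+1)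
    \prod_i f i (x + ((b i)%:Z - D%:Z) * m%:Z).

Lemma counting_operator_le (H D U W : nat) (lambda : {ffun 'I_k -> int} -> R[i])
    (f : 'I_k -> int -> R[i]) (i : 'I_k) : one_bounded lambda ->
  (forall b, lambda b <> 0 -> forall j, (`|b j| <= D)%N) ->
  (forall x, f i x <> 0 -> (`|x| <= U)%N) -> (U + D * H <= W)%N ->
  normc (counting_operator H lambda f) <= \sum_b normc (slice H D W f b).
Proof.
move=> lambda1 supp fU UW; rewrite /counting_operator.
pose v (b : {ffun 'I_k -> 'I_(2 * D).+1}) : {ffun 'I_k -> int} :=
  [ffun j => (b j)%:Z - D%:Z].
have v_inj : injective v.
  move=> b b' /ffunP bb'; apply/ffunP => j; apply: val_inj => /=.
  by have := bb' j; rewrite !ffunE; lia.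
rewrite (fsbigE (map v (enum {ffun 'I_k -> 'I_(2 * D).+1}))); last 3 first.
- by rewrite map_inj_uniq ?enum_uniq.
- by [].
- move=> b _ /= bv; have [->|/eqP lb] := eqVneq (lambda b) 0; first by rewrite mul0r.
  case/negP: bv; apply/mapP; exists [ffun j => inord (absz (b j + D%:Z))].
    by rewrite mem_enum.
  apply/ffunP => j; rewrite !ffunE inordK; have := supp _ lb j; move: (b j) => z; lia.
rewrite (eq_bigl xpredT) => [|b]; last by rewrite in_setT.
rewrite big_map big_enum /=; apply: le_trans (normc_sum _ _ _ _) _.
apply: ler_sum => b _; rewrite normcM.
apply: le_trans (ler_piMl (normc_ge0 _) (lambda1 _)) _; rewrite (fsum_window _ W) => [|x gx].
  rewrite le_eqVlt; apply/orP; left; apply/eqP; congr normc.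
  apply: eq_bigr => x _; apply: eq_bigr => m _; apply: eq_bigr => j _.
  by rewrite ffunE.
rewrite leqNgt; apply/negP => Wx; apply: gx; apply: big1_seq => m.
rewrite mem_index_iota ltnS => /andP[_ /andP[_ mH]].
rewrite (bigD1 i)//= (_ : f i _ = 0) ?mul0r//.
apply: contrapT => /fU; rewrite ffunE; have := ltn_ord (b i).
move: (nat_of_ord (b i)) => t tD.
have : (absz ((t%:Z - D%:Z) * m%:Z)%R <= D * H)%N by rewrite abszM leq_mul//; lia.
by move: Wx UW; lia.
Qed.

(** Phases [c t] remove the absolute values, so the sum over [t] can move inside the sum over
    [(x, m)]. There the other factors have modulus at most 1, and Cauchy-Schwarz in [(x, m)]
    finishes. *)
Lemma slice_energy (H D W : nat) (f : 'I_k -> int -> R[i]) (i : 'I_k)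
    (b : {ffun 'I_k -> 'I_(2 * D).+1}) : (forall j, one_bounded (f j)) ->
  exists2 c : 'I_(2 * D).+1 -> R[i], forall t, normc (c t) <= 1 &
    (\sum_t normc (slice H D W f (update_coord b i t))) ^+ 2 <=
    (W.*2.+1 * H)%:R * \sum_(1 <= m < H.+1) \sum_(x <- window W)
      normc (\sum_t c t * f i (x + (t%:Z - D%:Z) * m%:Z)) ^+ 2.
Proof.
move=> f1; pose S t := slice H D W f (update_coord b i t).
(* The conjugate phase of [S t]; it is 0 when [S t = 0], because the inverse of 0 is 0. *)
pose c t := ((normc (S t))^-1%:C)%C * ((S t)^*)%C.
have cS t : c t * S t = ((normc (S t))%:C)%C.
  rewrite /c -mulrA [_ * S t]mulrC -sqr_normcE -rmorphM; congr (_%:C)%C.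
  have [->|S0] := eqVneq (normc (S t)) 0; first by rewrite expr0n mulr0.
  by rewrite expr2 mulrA mulVf// mul1r.
have normcR (x : R) : 0 <= x -> normc (x%:C)%C = x.
  by move=> x0; rewrite /= expr0n addr0 sqrtr_sqr ger0_norm.
have c1 t : normc (c t) <= 1.
  rewrite normcM normc_conj normcR ?invr_ge0 ?normc_ge0//.
  have [->|S0] := eqVneq (normc (S t)) 0; first by rewrite mulr0.
  by rewrite mulVf.
exists c => //.
pose E x m := normc (\sum_t c t * f i (x + (t%:Z - D%:Z) * m%:Z)).
have -> : (W.*2.+1 * H)%N = size [seq (x, m) | x <- window W, m <- index_iota 1 H.+1].
  by rewrite size_allpairs size_window size_iota subSS subn0.
have -> : \sum_(1 <= m < H.+1) \sum_(x <- window W) E x m ^+ 2 =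
    \sum_(p <- [seq (x, m) | x <- window W, m <- index_iota 1 H.+1]) E p.1 p.2 ^+ 2.
  by rewrite exchange_big big_allpairs.
apply: le_trans (sqr_sum_le _ _ _ _).
rewrite big_allpairs lerXn2r ?nnegrE ?sumr_ge0//.
- by move=> t _; exact: normc_ge0.
- by move=> x _; apply: sumr_ge0 => m _; exact: normc_ge0.
have sum0 : 0 <= \sum_t normc (S t) by apply: sumr_ge0 => t _; exact: normc_ge0.
rewrite -/(S _) -[leLHS](normcR _ sum0) rmorph_sum /=.
under eq_bigr do rewrite -cS.
(* The factors with [j != i] are independent of [t], since only coordinate [i] moves along the
   line. *)
have -> : \sum_t c t * S t = \sum_(x <- window W) \sum_(1 <= m < H.+1)
    (\prod_(j | j != i) f j (x + ((b j)%:Z - D%:Z) * m%:Z)) *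
    \sum_t c t * f i (x + (t%:Z - D%:Z) * m%:Z).
  under eq_bigr do rewrite /S /slice mulr_sumr.
  rewrite exchange_big /=; apply: eq_bigr => x _.
  under eq_bigr do rewrite mulr_sumr.
  rewrite exchange_big /=; apply: eq_bigr => m _.
  rewrite mulr_sumr; apply: eq_bigr => t _.
  rewrite (bigD1 i)//= ffunE eqxx mulrA mulrC; congr (_ * _).
  by apply: eq_bigr => j /negPf ji; rewrite ffunE ji.
apply: le_trans (normc_sum _ _ _ _) _; apply: ler_sum => x _.
apply: le_trans (normc_sum _ _ _ _) _; apply: ler_sum => m _.
rewrite normcM ler_piMl ?normc_ge0// normc_prod.
by apply: prodr_ile1 => j; rewrite normc_ge0 f1.
Qed.

End Reduction.

(** * Choice of the parameters *)

(** After multiplication by [delta ^+ 10] the left sides are of order [a0 * delta ^+ 8] and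
    [a0 ^+ 2 * delta ^+ 6], which a small [delta] keeps below 1. *)
Lemma scale_bounds {R : realFieldType} {a0 delta A B H : R} : 1 <= a0 ->
  0 < delta -> delta * (192 * a0 ^+ 2) <= 1 -> 0 <= A ->
  A * delta ^+ 2 <= 2 * a0 -> 1 <= B * delta ^+ 10 -> 1 <= H * delta ^+ 10 ->
  2 * A < B /\ 48 * A ^+ 2 <= H.
Proof.
move=> a1 d0 da A0 Ad Bd Hd.
have a2 : a0 <= a0 ^+ 2 by rewrite ler_eXnr.
have d1 : delta <= 1.
  by apply: le_trans da; rewrite ler_peMr ?ltW//; lra.
have dX (n : nat) : delta ^+ n.+1 <= delta by rewrite ler_iXnr// ltW.
have dX0 (n : nat) : 0 < delta ^+ n by rewrite exprn_gt0.
have d192 : delta ^+ 6 * (192 * a0 ^+ 2) <= 1.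
  by apply: le_trans da; rewrite ler_wpM2r//; lra.
have d8 : delta ^+ 8 * (4 * a0) < 1.
  apply: le_lt_trans (_ : delta ^+ 8 * (4 * a0) <= delta * (4 * a0)) _.
    by rewrite ler_wpM2r//; lra.
  by nra.
split.
  rewrite -(ltr_pM2r (dX0 10)); apply: lt_le_trans Bd.
  rewrite (_ : 2 * A * delta ^+ 10 = delta ^+ 8 * (2 * (A * delta ^+ 2))); last by ring.
  by apply: le_lt_trans d8; rewrite ler_wpM2l ?(ltW (dX0 8))//; lra.
rewrite -(ler_pM2r (dX0 10)); apply: le_trans Hd.
rewrite (_ : 48 * A ^+ 2 * delta ^+ 10 = delta ^+ 6 * (48 * (A * delta ^+ 2) ^+ 2)); last by ring.
apply: le_trans d192; rewrite ler_wpM2l ?(ltW (dX0 6))//.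
have : (A * delta ^+ 2) ^+ 2 <= (2 * a0) ^+ 2.
  by rewrite lerXn2r ?nnegrE ?mulr_ge0// ?ltW//; lra.
by rewrite exprMn; lra.
Qed.

Lemma energy_bound {R : realFieldType} {C0 N H B delta tau n S E : R} :
  0 < H -> 0 < N -> 0 < B -> 0 < delta ->  1 <= C0 -> 0 < tau ->
  0 <= n <= 7 * C0 * N -> 0 <= E ->
  delta * B * N * H <= tau * S -> S ^+ 2 <= n * H * E ->
  (delta * B) ^+ 2 * (N * H) <= 7 * C0 * tau ^+ 2 * E.
Proof.
move=> H0 N0 B0 d0 C01 tau0 /andP[n0 nN] E0 Sle S2.
have NH : 0 < N * H by rewrite mulr_gt0.
rewrite -(ler_pM2r NH).
have sq : (delta * B * N * H) ^+ 2 <= (tau * S) ^+ 2.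
  have x0 : 0 <= delta * B * N * H by rewrite !mulr_ge0 ?ltW.
  by rewrite lerXn2r ?nnegrE// (le_trans x0).
have h1 : tau ^+ 2 * S ^+ 2 <= tau ^+ 2 * (n * H * E).
  by rewrite ler_wpM2l ?sqr_ge0.
have h2 : tau ^+ 2 * H * E * n <= tau ^+ 2 * H * E * (7 * C0 * N).
  by rewrite ler_wpM2l// !mulr_ge0// ?sqr_ge0// ltW.
have -> : (delta * B) ^+ 2 * (N * H) * (N * H) = (delta * B * N * H) ^+ 2 by ring.
apply: le_trans sq _; rewrite exprMn; lra.
Qed.

(** Eliminating [L] loses [A ^+ 3] and the energy step [A ^+ 2], so [N] is at most a constant times
    [C0 * A ^+ 5 * T]. With [A] of order [a0 / delta ^+ 2] this gives [delta ^+ 10]; the spare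
    [a0 ^+ 2] in [a0 ^+ 7] absorbs the numerical constant. *)
Lemma progression_bound {R : realFieldType} {a0 delta A C0 N N' L V T : R} :
  420 <= a0 -> 0 < delta -> 1 <= C0 -> 0 < N -> 0 < A -> 0 <= T ->
  A * delta ^+ 2 <= 2 * a0 -> N <= 96 * A ^+ 3 * L -> N <= 2 * N' ->
  V <= 7 * C0 * N -> L * N' <= 4 * A ^+ 2 * V * T ->
  (C0 * a0 ^+ 7)^-1 * delta ^+ 10 <= T / N.
Proof.
move=> a1 d0 C01 N0 A0 T0 Ad NL NN' VN LN.
have den0 : 0 < C0 * a0 ^+ 7 by rewrite mulr_gt0 ?exprn_gt0//; lra.
rewrite mulrC ler_pdivrMr// mulrAC ler_pdivlMr//.
have A3 : 0 < 96 * A ^+ 3 by rewrite mulr_gt0// exprn_gt0.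
have L0 : 0 <= L by rewrite -(pmulr_rge0 _ A3); lra.
have NN : N * N <= 96 * A ^+ 3 * L * (2 * N').
  by rewrite ler_pM// ltW.
have LNA : 192 * A ^+ 3 * (L * N') <= 192 * A ^+ 3 * (4 * A ^+ 2 * V * T).
  by rewrite ler_wpM2l// mulr_ge0// exprn_ge0// ltW.
have VNA : 768 * A ^+ 5 * T * V <= 768 * A ^+ 5 * T * (7 * C0 * N).
  by rewrite ler_wpM2l// mulr_ge0// mulr_ge0// exprn_ge0// ltW.
have {NN LNA VNA} NA : N <= 84 * 64 * C0 * A ^+ 5 * T.
  by rewrite -(ler_pM2r N0); lra.
have A5 : (A * delta ^+ 2) ^+ 5 <= (2 * a0) ^+ 5.
  have Ad0 : 0 <= A * delta ^+ 2 by rewrite mulr_ge0 ?sqr_ge0// ltW.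
  by rewrite lerXn2r ?nnegrE//; lra.
have := ler_wpM2l (exprn_ge0 10 (ltW d0)) NA.
have CT : 0 <= 84 * 64 * C0 * T by rewrite !mulr_ge0//; lra.
have := ler_wpM2l CT A5; rewrite !exprMn.
have aa : 84 * 64 * 32 <= a0 ^+ 2 by nra.
have CaT : 0 <= C0 * a0 ^+ 5 * T by rewrite !mulr_ge0 ?exprn_ge0//; lra.
have := ler_wpM2l CaT aa; lra.
Qed.

Theorem theorem1p3 (R : realType) (k : nat) (hk : (2 <= k)%N) :
  exists2 C : R, 1 <= C &
  forall C0 : R, 1 <= C0 ->
  exists2 c : R, 0 < c &
  forall N : R, 1 <= N ->
  forall delta : R, 0 < delta < c ->
  forall H : nat, (0 < H)%N ->
  forall B : R, B = N / H%:R ->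
  delta `^ (- C) <= B <= N * delta `^ C ->
  forall lambda : {ffun 'I_k -> int} -> R[i],
  one_bounded lambda ->
  supported_on lambda
    [set b : {ffun 'I_k -> int} | forall i, - (C0 * B) <= (b i)%:~R <= C0 * B] ->
  forall f : 'I_k -> int -> R[i],
  (forall i, one_bounded (f i)) ->
  (forall i, supported_on (f i) (initial_segment N)) ->
  delta * B ^+ k * (N ^+ 2 / B) <= normc (counting_operator H lambda f) ->
  forall i, c * delta `^ C <= U1plus_norm N (f i).
Proof.
(* Ten is twice five: [A], of order [delta ^- 2], enters the final bound to the fifth power. *)
exists 10%:R; first by rewrite ler1n.
(* [tau] bounds [((2 * D + 1) / B) ^+ k.-1], as [2 * D + 1 <= 3 * C0 * B]. *)
move=> C0 C01; pose tau := (3 * C0) ^+ k.-1.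
(* Here [420 = 7 * 4 * 15]: 7 from [2 * W + 1 <= 7 * C0 * N], 4 from the energy hypothesis, and 15
   from [(2 * D + 1) * (4 * D + 1) <= 15 * (C0 * B) ^+ 2]. *)
have [a0 a0E] : exists a0, a0 = 420 * C0 ^+ 3 * tau ^+ 2 by exists (420 * C0 ^+ 3 * tau ^+ 2).
have tau1 : 1 <= tau by rewrite exprn_ege1//; lra.
have C03 : 1 <= C0 ^+ 3 by rewrite exprn_ege1.
have tau2 : 1 <= tau ^+ 2 by rewrite exprn_ege1.
have a1 : 1 <= a0 by rewrite a0E mulr_ege1//; lra.
have a420 : 420 <= a0.
  by rewrite a0E -mulrA ler_peMr// mulr_ege1.
have c0 : 0 < C0 * a0 ^+ 7 by rewrite mulr_gt0 ?exprn_gt0//; lra.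
(* This constant is both the threshold for [delta], through [d192], and the factor in the
   conclusion. *)
exists (C0 * a0 ^+ 7)^-1; first by rewrite invr_gt0.
move=> N N1 delta /andP[d0 dc] H H0 B BE.
rewrite powRN powR_mulrn ?(ltW d0)// => /andP[dB BN].
move=> lambda lambda1 lambda_supp f f1 f_supp large i.
have N0 : 0 < N by lra.
have H0r : 0 < H%:R :> R by rewrite ltr0n.
have BH : B * H%:R = N by rewrite BE divfK// gt_eqF.
have B0 : 0 < B by rewrite BE divr_gt0.
have d10 : 0 < delta ^+ 10 by rewrite exprn_gt0.
have Bd : 1 <= B * delta ^+ 10 by rewrite -ler_pdivrMr// div1r.
(* Since [N = B * H], the upper bound on [B] is a lower bound on [H]. *)
have Hd : 1 <= H%:R * delta ^+ 10.
  by rewrite -(ler_pM2l B0) mulr1 mulrA BH.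
have d192 : delta * (192 * a0 ^+ 2) <= 1.
  apply: le_trans (_ : delta * (C0 * a0 ^+ 7) <= 1); last first.
    by rewrite -ler_pdivlMr// div1r ltW.
  have a37 : a0 ^+ 3 <= a0 ^+ 7 by rewrite ler_weXn2l.
  have a23 : 420 * a0 ^+ 2 <= a0 ^+ 3 by rewrite [leRHS]exprS ler_wpM2r// sqr_ge0.
  have C07 : a0 ^+ 7 <= C0 * a0 ^+ 7 by rewrite ler_peMl// exprn_ge0//; lra.
  have a20 : 0 <= a0 ^+ 2 by exact: sqr_ge0.
  by rewrite ler_wpM2l ?(ltW d0)//; lra.
have d1 : delta <= 1.
  apply: le_trans d192; rewrite ler_peMr ?(ltW d0)//.
  by rewrite mulr_ege1 ?exprn_ege1//; lra.
have B1 : 1 <= B.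
  by apply: le_trans Bd _; rewrite ler_piMr ?(ltW B0)// exprn_ile1 ?(ltW d0).
have d2 : 0 < delta ^+ 2 by rewrite exprn_gt0.
have ad1 : 1 <= a0 / delta ^+ 2.
  rewrite ler_pdivlMr// mul1r (le_trans _ a1)// exprn_ile1// ltW//.
(* An integer between [a0 / delta ^+ 2] and twice that. *)
pose A := (Num.trunc (a0 / delta ^+ 2)).+1.
have Alo : a0 <= A%:R * delta ^+ 2.
  by rewrite -ler_pdivrMr// ltW// truncnS_gt.
have Ahi : A%:R * delta ^+ 2 <= 2 * a0.
  rewrite -ler_pdivlMr// /A -natr1 -mulrA.
  have : (Num.trunc (a0 / delta ^+ 2))%:R <= a0 / delta ^+ 2.
    by rewrite truncn_le; lra.
  by lra.
have A0r : 0 < A%:R :> R by rewrite ltr0n.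
have [AB AH] := scale_bounds a1 d0 d192 (ltW A0r) Ahi Bd Hd.
pose N' := `|Num.floor N|%N; pose D := Num.trunc (C0 * B).
have CB0 : 0 <= C0 * B by rewrite mulr_ge0 ?ltW//; lra.
have /andP[Dlo Dhi] := truncn_itv CB0; rewrite -/D in Dlo Dhi.
have CB : B <= C0 * B by rewrite ler_peMl// ltW.
have D1 : 1 <= D%:R :> R by rewrite ler1n truncn_gt0; lra.
have floorN : (N'%:Z = Num.floor N)%R.
  by rewrite /N' gez0_abs// floor_ge0 ltW.
have N'N : N'%:R <= N by rewrite -[_%:R]/(N'%:Z%:~R) floorN floor_le.
have NN' : N <= 2 * N'%:R.
  have := floorD1_gt N; rewrite -floorN intrD -[N'%:Z%:~R]/N'%:R.
  have : 1 <= N'%:R :> R by rewrite ler1n absz_gt0 gt_eqF// floor_gt0.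
  by lra.
(* The largest [L] with [48 * A ^+ 3 * L <= N]; it is positive because [A <= B] and
   [48 * A ^+ 2 <= H]. *)
pose L := Num.trunc (N / (48 * A%:R ^+ 3)).
have A3 : 0 < 48 * A%:R ^+ 3 :> R by rewrite mulr_gt0// exprn_gt0.
have A1 : 1 <= A%:R :> R by rewrite ler1n.
have NA : 48 * A%:R ^+ 3 <= N.
  have A2 : 0 <= 48 * A%:R ^+ 2 :> R by rewrite mulr_ge0// sqr_ge0.
  have AB' : A%:R <= B by lra.
  rewrite -BH (_ : 48 * A%:R ^+ 3 = A%:R * (48 * A%:R ^+ 2)); last by ring.
  exact: ler_pM (ltW A0r) A2 AB' AH.
have NL0 : 0 <= N / (48 * A%:R ^+ 3) by rewrite divr_ge0// ltW.
have /andP[Llo Lhi] := truncn_itv NL0; rewrite -/L in Llo Lhi.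
have L1 : (0 < L)%N by rewrite truncn_gt0 ler_pdivlMr// mul1r.
have LN : 48 * A%:R ^+ 3 * L%:R <= N by rewrite mulrC -ler_pdivlMr.
have NL : N <= 96 * A%:R ^+ 3 * L%:R.
  have : L.+1%:R <= 2 * L%:R :> R by rewrite -natrM ler_nat; clear -L1; lia.
  rewrite ltr_pdivrMr// in Lhi; move=> L2.
  by have := ler_wpM2r (ltW A3) L2; lra.
(* One [N'] holds the support, the other the translates [q * l < 2 * A * L]; [D * H] holds the
   translates [(t - D) * m]. *)
pose W := (2 * N' + D * H)%N.
have DHN : D%:R * H%:R <= C0 * N.
  by rewrite -BH mulrA ler_wpM2r.
have VN : W.*2.+1%:R <= 7 * C0 * N.
  have CN : N <= C0 * N by rewrite ler_peMl// ltW.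
  by rewrite -natr1 -muln2 natrM natrD !natrM; lra.
have suppN j x : f j x <> 0 -> 1 <= x <= N'%:Z by move/f_supp; rewrite floorN.
have lambdaD b : lambda b <> 0 -> forall j, (`|b j| <= D)%N.
  move=> /lambda_supp /= bB j; rewrite truncn_ge_nat// -[_%:R]/(`|b j|%N%:Z%:~R).
  by rewrite abszE intr_norm ler_norml.
have suppU x : f i x <> 0 -> (`|x| <= N')%N.
  by move/suppN; clear; lia.
have NW : (N' + D * H <= W)%N by rewrite leq_add2r leq_pmull.
have le_slices := counting_operator_le H D _ W _ f i lambda1 lambdaD suppU NW.
have [b heavy] := exists_heavy_line _ (fun b => normc (slice H D W f b)) i.
have [c c1 energy] := slice_energy H D W f i b f1.
set S := \sum_t normc (slice H D W f (update_coord b i t)) in heavy energy.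
set E := \sum_(1 <= m < H.+1) _ in energy.
have E0 : 0 <= E.
  by apply: sumr_ge0 => m _; apply: sumr_ge0 => x _; rewrite sqr_ge0.
have S0 : 0 <= S by apply: sumr_ge0 => t _; exact: normc_ge0.
have kE : k = k.-1.+1 by rewrite prednK// (leq_trans _ hk).
have D2 : (2 * D).+1%:R <= 3 * (C0 * B) by rewrite -natr1 natrM; lra.
have Sbig : delta * B * N * H%:R <= tau * S.
  have B0k : 0 < B ^+ k.-1 by rewrite exprn_gt0.
  have D0 : 0 < (2 * D).+1%:R :> R by [].
  have step : delta * B ^+ k * (N ^+ 2 / B) <= (2 * D).+1%:R ^+ k.-1 * S.
    apply: le_trans large _; apply: le_trans le_slices _.
    by rewrite -(ler_pM2l D0) mulrA -exprS -kE.
  rewrite -(ler_pM2l B0k).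
  have -> : B ^+ k.-1 * (delta * B * N * H%:R) = delta * B ^+ k * (N ^+ 2 / B).
    rewrite [in RHS]kE exprS -BH; field.
    by rewrite gt_eqF.
  apply: le_trans step _; rewrite mulrA ler_wpM2r// /tau -exprMn.
  rewrite mulrA mulrC in D2.
  have BC0 : 0 <= B * (3 * C0) by exact: le_trans (ltW D0) D2.
  by rewrite lerXn2r// ?nnegrE// ltW.
have V0 : 0 <= (W.*2.+1%:R : R) <= 7 * C0 * N by apply/andP; split.
rewrite natrM in energy.
have Ebig := energy_bound H0r N0 B0 d0 C01 (lt_le_trans ltr01 tau1) V0 E0 Sbig energy.
have AD : (2 * A < (4 * D).+1)%N.
  by rewrite -(@ltr_nat R) -natr1 !natrM; lra.
have [|||||q [x [q0 qx]]] := progression_of_large_energy (f i) N' D H A L W c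
  (f1 i) (suppN i) c1 (ltn0Sn _) L1 AD.
- by rewrite -(@ler_nat R) natrM natrX.
- rewrite -(@ler_nat R) !natrM; have A2 : A%:R <= A%:R ^+ 3 :> R by rewrite ler_eXnr.
  have := ler_wpM2r (ler0n R L) A2; lra.
- have AL : (48 * A ^ 3 * L)%:R = 48 * A%:R ^+ 3 * L%:R :> R.
    by rewrite -natrX -!natrM.
  rewrite -(@ler_nat R) AL natrM; apply: le_trans LN _; rewrite -BH.
  by rewrite ler_wpM2r// -natr1 natrM; lra.
- by [].
- rewrite -/E !natrM.
  have D4 : (4 * D).+1%:R <= 5 * (C0 * B) by rewrite -natr1 natrM; lra.
  have DD : (2 * D).+1%:R * (4 * D).+1%:R <= 3 * (C0 * B) * (5 * (C0 * B)).
    by rewrite ler_pM.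
  have HN : H%:R * N'%:R <= N * H%:R by rewrite mulrC ler_wpM2r.
  have DHN' := ler_pM _ _ DD HN.
  rewrite -(ler_pM2l d2).
  have aE : a0 * E <= A%:R * delta ^+ 2 * E by rewrite ler_wpM2r.
  have C060 : 0 <= 60 * C0 ^+ 2 by rewrite mulr_ge0// sqr_ge0.
  have := ler_wpM2l C060 Ebig.
  have := ler_wpM2l (ltW d2) (DHN' _ _).
  rewrite !mulr_ge0// => /(_ isT isT).
  rewrite a0E in aE; lra.
apply: le_trans (U1plus_norm_ge _ _ _ q L x N1 (f_supp i) q0).
apply: (progression_bound a420 d0 C01 N0 A0r (normc_ge0 _) Ahi NL NN' VN).
have AV : (4 * A ^ 2 * W.*2.+1)%:R = 4 * A%:R ^+ 2 * W.*2.+1%:R :> R.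
  by rewrite -natrX -!natrM.
by move: qx; rewrite natrM AV.
Qed.
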